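(* Let $r,s,t$ and $n$ be positive integers. Then $$\sum_{k=-n}^{n}(-1)^k\binom{6n}{3n+k}^r\binom{4n}{2n+k}^s\binom{2n}{n+k}^t\equiv 0\pmod{2\binom{6n}{n}}$$ and $$\sum_{k=-n}^{n}(-1)^k\binom{6n}{3n+k}^r\binom{4n}{2n+k}^s\binom{2n}{n+k}^t\equiv 0\pmod{6\binom{6n}{3n}}.$$ Furthermore, if $(r,s,t)\neq(1,1,1)$, then $$\sum_{k=-n}^{n}(-1)^k\binom{8n}{4n+k}^r\binom{4n}{2n+k}^s\binom{2n}{n+k}^t\equiv 0\pmod{2\binom{8n}{3n}}.$$
   Context: All congruences are between integers; the binomial coefficients are the ordinary ones. *)

(* Defs.v *)
From mathcomp Require Import all_boot all_order all_algebra.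
Set Implicit Arguments.
Unset Strict Implicit.
Unset Printing Implicit Defensive.
Import Order.TTheory GRing.Theory Num.Theory.
Local Open Scope ring_scope.

(* The integers a, a + 1, ..., b in increasing order; empty when b < a. *)
Definition zrange (a b : int) : seq int :=
  if a <= b then [seq a + i%:Z | i <- iota 0 `|b - a|%N.+1] else [::].

Lemma mem_zrange (a b k : int) : (k \in zrange a b) = (a <= k <= b).
Proof.
rewrite /zrange; case: ifPn => [leab|]; last first.
  move=> nab; rewrite in_nil; apply/esym/negbTE.
  by apply: contra nab => /andP[]; exact: le_trans.
have eab : `|b - a|%N%:Z = b - a by rewrite gez0_abs // subr_ge0.
apply/mapP/andP => [[i] | [leak lekb]].
  rewrite mem_iota /= add0n ltnS => lei ->; rewrite lerDl; split=> //.
  by rewrite -lerBrDl -eab lez_nat.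
exists `|k - a|%N; last by rewrite gez0_abs ?subr_ge0 // subrKC.
rewrite mem_iota /= add0n ltnS -lez_nat eab gez0_abs ?subr_ge0 //.
by rewrite lerD2r.
Qed.

Lemma uniq_zrange (a b : int) : uniq (zrange a b).
Proof.
rewrite /zrange; case: ifP => // _; rewrite map_inj_uniq ?iota_uniq //.
by move=> i j /addrI[].
Qed.

(* Binomial coefficient with an integer lower index, zero when it is
   negative. *)
Definition zbin (m : nat) (k : int) : int :=
  if k is Posz j then 'C(m, j)%:Z else 0.

(* Main.v *)
Require Import Defs.
From mathcomp Require Import all_boot all_order all_algebra.
From mathcomp Require Import zify ring.
Set Implicit Arguments.
Unset Strict Implicit.
Unset Printing Implicit Defensive.
Import Order.TTheory GRing.Theory Num.Theory.

(** Up to factorials, the product of powers of [binom(2a, a+k)] is a product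
of [1 / ((a-k)! (a+k)!)] over a list [a_1, ..., a_m], which may be put in any
order.  Vandermonde's identity expands the factors of [a_1] and [a_2] into
those of a single [u <= a_1]; iterating gives a formula for the alternating
sum as an explicit quotient of factorials times the nonnegative integer
[vdm_sum], a multiple sum over [a_1 >= u_1 >= u_2 >= ...] of products of
[binom(u_(i-1), u_i) binom(a_(i+1) + a_(i+2), a_(i+2) + u_i)], with
[u_0 = a_1].

The extra factors 2 and 3 divide [vdm_sum] term by term for a suitable order of
the list: [binom(N, j)] is divisible by the prime [p] when [p^e] divides [N]
but not [j].  So if [p^e] divides [a_1], in the remaining terms it divides
every [u_i], and then a pair of neighbours with [p^e | a_i + a_(i+1)] and
[p^e] not dividing [a_i] contributes a binomial coefficient divisible by [p].
The list [2n, n, 4n, ..., 4n] has no such pair; there one summation is carried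
out in closed form first. *)

Lemma big_ord_take (R : Type) (idx : R) {op : Monoid.law idx} m n
    (F : nat -> R) :
  m <= n -> (forall i, m <= i -> F i = idx) ->
  \big[op/idx]_(i < n) F i = \big[op/idx]_(i < m) F i.
Proof.
move=> le_mn F0; rewrite (big_ord_widen _ F le_mn) [RHS]big_rmcond // => i.
by rewrite -leqNgt => /F0.
Qed.

Lemma big_ord_drop (R : Type) (idx : R) {op : Monoid.law idx} m n
    (F : nat -> R) :
  m <= n -> (forall i, i < m -> F i = idx) ->
  \big[op/idx]_(i < n) F i = \big[op/idx]_(i < n - m) F (m + i).
Proof.
move=> le_mn F0; rewrite -[in LHS](subnKC le_mn) big_split_ord /=.
by rewrite big1 ?Monoid.mul1m // => i _; apply: F0.
Qed.

Lemma last_nseq (T : Type) (x : T) n : last x (nseq n x) = x.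
Proof. by elim: n. Qed.

Lemma bin_factD m n : 'C(m + n, m) * (m`! * n`!) = (m + n)`!.
Proof. by rewrite -(bin_fact (leq_addr n m)) addKn. Qed.

Lemma prime_dvd_bin_expn p e a b :
  prime p -> p ^ e %| a -> ~~ (p ^ e %| b) -> p %| 'C(a, b).
Proof.
move=> p_pr dvd_a; case: b => [|b]; first by rewrite dvdn0.
apply: contraR => p_ndvd.
have cop : coprime (p ^ e) 'C(a, b.+1) by rewrite coprimeXl // prime_coprime.
rewrite -(Gauss_dvdl _ cop); case: a dvd_a {p_ndvd cop} => [|a] dvd_a.
  by rewrite bin0n muln0 dvdn0.
by rewrite -mul_bin_diag dvdn_mulr.
Qed.

Lemma prime_dvd_bin_modn p e a b :
  prime p -> a %% p ^ e < b %% p ^ e -> p %| 'C(a, b).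
Proof.
move=> p_pr lt_ab; rewrite {1}(divn_eq a (p ^ e)) -binomial.Vandermonde.
apply: dvdn_sum => -[j /= lt_jb] _.
have [dvd_j|ndvd_j] := boolP (p ^ e %| j); last first.
  by rewrite dvdn_mulr // (prime_dvd_bin_expn p_pr _ ndvd_j) // dvdn_mull.
rewrite [X in _ * X]bin_small ?muln0 //; apply: leq_trans lt_ab _.
case/dvdnP: dvd_j lt_jb => q ->; rewrite ltnS => le_qb.
by rewrite -{1}(subnKC le_qb) modnMDl leq_mod.
Qed.

Lemma prime_dvd_bin_modn_pMl p d e a b :
  prime p -> a %% p ^ e < b %% p ^ e -> p %| 'C(p ^ d * a, p ^ d * b).
Proof.
move=> p_pr lt_ab; apply: (prime_dvd_bin_modn (e := d + e)) => //.
by rewrite expnD -!muln_modr ltn_pmul2l // expn_gt0 prime_gt0.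
Qed.

Lemma sum_bin_bin_shift a m c :
  \sum_(j < a.+1) 'C(a, j) * 'C(m, c + j) = 'C(a + m, c + a).
Proof.
pose F j := 'C(a, j) * 'C(m, c + a - j).
rewrite -binomial.Vandermonde (big_ord_take (m := a.+1) (F := F)); first last.
- by move=> j lt_aj; rewrite /F bin_small.
- by rewrite ltnS leq_addl.
rewrite (reindex_inj rev_ord_inj) /=; apply: eq_bigr => -[j /= le_ja] _.
by rewrite /F subSS bin_sub // addnBA.
Qed.

Lemma bin_trinomial_revision a u j :
  u + j <= a -> 'C(a, u + j) * 'C(u + j, u) = 'C(a, u) * 'C(a - u, j).
Proof.
move=> le_a; have le_ua := leq_trans (leq_addr j u) le_a.
have le_j : j <= a - u by rewrite leq_subRL.
have facts_gt0 : 0 < u`! * (j`! * (a - u - j)`!).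
  by rewrite !muln_gt0 !fact_gt0.
apply/eqP; rewrite -(eqn_pmul2r facts_gt0); apply/eqP.
have := bin_fact (leq_addr j u); rewrite addKn => fact_uj.
transitivity a`!.
  by rewrite -(bin_fact le_a) -subnDA -fact_uj; ring.
by rewrite -(bin_fact le_ua) -(bin_fact le_j); ring.
Qed.

Lemma sum_bin_bin_bin a m c u : u <= a ->
  \sum_(s < a.+1) 'C(a, s) * 'C(s, u) * 'C(m, c + s)
    = 'C(a, u) * 'C(a - u + m, c + a).
Proof.
move=> le_ua.
pose F s := 'C(a, s) * 'C(s, u) * 'C(m, c + s).
rewrite (big_ord_drop (m := u) (F := F)); first last.
- by move=> s lt_su; rewrite /F (bin_small lt_su) muln0.
- exact: leqW.
have -> : c + a = c + u + (a - u) by rewrite -addnA subnKC.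
rewrite -sum_bin_bin_shift big_distrr subSn //.
apply: eq_bigr => -[j /= le_j] _.
by rewrite /F bin_trinomial_revision -?leq_subRL // !mulnA addnA.
Qed.

(* The value at [::] makes [altbinsum_vdm_sum] hold for one-element lists. *)
Fixpoint vdm_sum (a : nat) (l : seq nat) : nat :=
  if l is b :: l' then
    if l' is c :: _ then
      \sum_(s < a.+1) 'C(a, s) * 'C(b + c, c + s) * vdm_sum s l'
    else 1
  else (a == 0).

Arguments vdm_sum : simpl never.

Lemma vdm_sum_cons2 a b c l :
  vdm_sum a [:: b, c & l] =
  \sum_(s < a.+1) 'C(a, s) * 'C(b + c, c + s) * vdm_sum s (c :: l).
Proof. by []. Qed.

Lemma vdm_sum_cons3 a b c d l :
  vdm_sum a [:: b, c, d & l] =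
  \sum_(u < a.+1)
    'C(a, u) * 'C(a - u + (b + c), c + a) * 'C(c + d, d + u)
      * vdm_sum u (d :: l).
Proof.
pose G u := 'C(c + d, d + u) * vdm_sum u (d :: l).
transitivity (\sum_(s < a.+1) \sum_(u < a.+1)
    'C(a, s) * 'C(s, u) * 'C(b + c, c + s) * G u).
  rewrite vdm_sum_cons2; apply: eq_bigr => s _.
  rewrite (big_ord_take (F := fun u => _ * 'C(s, u) * _ * G u) (ltn_ord s)).
    rewrite vdm_sum_cons2 big_distrr; apply: eq_bigr => u _.
    by rewrite /G /=; ring.
  by move=> u lt_su; rewrite (bin_small lt_su) muln0 !mul0n.
rewrite exchange_big; apply: eq_bigr => -[u /= le_ua] _.
by rewrite -big_distrl /= sum_bin_bin_bin // /G !mulnA.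
Qed.

Lemma prime_dvd_vdm_sum_cons2 p e a b c l : prime p -> p ^ e %| a ->
  (forall s, p ^ e %| s -> p %| 'C(b + c, c + s) * vdm_sum s (c :: l)) ->
  p %| vdm_sum a [:: b, c & l].
Proof.
move=> p_pr dvd_a dvd_term; rewrite vdm_sum_cons2; apply: dvdn_sum => s _.
rewrite -mulnA; have [dvd_s|ndvd_s] := boolP (p ^ e %| s).
  by rewrite dvdn_mull ?dvd_term.
by rewrite dvdn_mulr // (prime_dvd_bin_expn p_pr dvd_a).
Qed.

Lemma prime_dvd_vdm_sum_expn p e a l1 b c l2 : prime p -> p ^ e %| a ->
  p ^ e %| b + c -> ~~ (p ^ e %| b) -> p %| vdm_sum a (l1 ++ [:: b, c & l2]).
Proof.
move=> p_pr + dvd_bc ndvd_b; elim: l1 a => [|x l1 IHl] a dvd_a.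
  apply: (prime_dvd_vdm_sum_cons2 p_pr dvd_a) => s dvd_s.
  apply/dvdn_mulr/(prime_dvd_bin_expn p_pr dvd_bc).
  apply: contra ndvd_b => dvd_cs.
  by rewrite -(dvdn_addl _ dvd_cs) addnA dvdn_add.
case: l1 IHl => [|y l1] IHl; apply: (prime_dvd_vdm_sum_cons2 p_pr dvd_a);
  by move=> s dvd_s; apply/dvdn_mull/IHl.
Qed.

Lemma prime_dvd_vdm_sum p a l1 b c l2 : prime p -> 0 < a -> 0 < b ->
  logn p b < logn p a -> logn p b < logn p (b + c) ->
  p %| vdm_sum a (l1 ++ [:: b, c & l2]).
Proof.
move=> p_pr a_gt0 b_gt0 lt_ba lt_bc.
apply: (prime_dvd_vdm_sum_expn (e := (logn p b).+1)) => //.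
- by rewrite pfactor_dvdn.
- by rewrite pfactor_dvdn // addn_gt0 b_gt0.
- by rewrite pfactor_dvdn // ltnn.
Qed.

Definition blocks (a r b s c t : nat) : seq nat :=
  nseq r a ++ nseq s b ++ nseq t c.

Lemma perm_blocksCA a r b s c t :
  perm_eq (blocks a r b s c t) (blocks b s a r c t).
Proof. exact/permEl/perm_catCA. Qed.

Lemma perm_blocksAC a r b s c t :
  perm_eq (blocks a r b s c t) (blocks a r c t b s).
Proof. by rewrite perm_cat2l perm_catC. Qed.

Lemma prime_dvd_vdm_sum_blocks p a b c r s t : prime p -> 0 < a -> 0 < b ->
  logn p b < logn p a -> logn p b < logn p (b + c) ->
  p %| vdm_sum a (blocks a r b s.+1 c t.+1).
Proof.
have snoc_b : nseq s.+1 b = rcons (nseq s b) b by elim: s => //= s <-.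
by rewrite /blocks snoc_b cat_rcons catA; apply: prime_dvd_vdm_sum.
Qed.

Lemma even_vdm_sum_twins a l1 b l2 : 0 < a -> 0 < b -> logn 2 b < logn 2 a ->
  2 %| vdm_sum a (l1 ++ [:: b, b & l2]).
Proof.
move=> a_gt0 b_gt0 lt_ba; apply: prime_dvd_vdm_sum => //.
by rewrite addnn -mul2n lognM.
Qed.

Lemma even_bin_2n_7n_8n n u : 0 < n -> u <= 2 * n ->
  2 %| 'C(2 * n, u) * 'C(7 * n - u, 6 * n) * 'C(8 * n, 4 * n + u).
Proof.
move=> n_gt0; have [m] := pfactor_coprime (isT : prime 2) n_gt0.
rewrite coprime2n mulnC; move: (logn 2 n) => d m_odd -> le_u.
have [/dvdnP[v def_u]|ndvd_u] := boolP (2 ^ d %| u); last first.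
  apply/dvdn_mull/(prime_dvd_bin_expn (e := d)) => //.
    by rewrite mulnCA dvdn_mulr.
  by rewrite dvdn_addr // mulnCA dvdn_mulr.
rewrite {u}def_u [v * _]mulnC in le_u *.
rewrite ![_ * (2 ^ d * m)]mulnCA -mulnBr -mulnDr in le_u *.
have le_v : v <= 2 * m by rewrite leq_pmul2l ?expn_gt0 in le_u.
have [v4|v_ne4] := boolP (v %% 8 == 4); last first.
  by apply/dvdn_mull/(prime_dvd_bin_modn_pMl _ (e := 3)) => //; lia.
apply: dvdn_mulr; have [m1|m_ne1] := boolP (m %% 4 == 1).
  by apply/dvdn_mulr/(prime_dvd_bin_modn_pMl _ (e := 3)) => //; lia.
by apply/dvdn_mull/(prime_dvd_bin_modn_pMl _ (e := 2)) => //; lia.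
Qed.

Lemma even_vdm_sum_2n_n_4n n r :
  0 < n -> 2 %| vdm_sum (2 * n) (n :: nseq r.+2 (4 * n)).
Proof.
move=> n_gt0; rewrite vdm_sum_cons3; apply: dvdn_sum => -[u /= le_u] _.
have -> : 2 * n - u + (n + 4 * n) = 7 * n - u by lia.
have -> : 4 * n + 2 * n = 6 * n by lia.
have -> : 4 * n + 4 * n = 8 * n by lia.
by rewrite dvdn_mulr // even_bin_2n_7n_8n.
Qed.

Local Open Scope ring_scope.

Lemma natr_fact_neq0 (R : numDomainType) n : n`!%:R != 0 :> R.
Proof. by rewrite pnatr_eq0 -lt0n fact_gt0. Qed.

Lemma natr_bin (R : numFieldType) n m : (m <= n)%N ->
  'C(n, m)%:R = n`!%:R / (m`!%:R * (n - m)`!%:R) :> R.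
Proof.
move=> le_mn; apply: (canRL (mulfK _)).
  by rewrite mulf_neq0 ?natr_fact_neq0.
by rewrite -!natrM bin_fact.
Qed.

(* ['C(a, s) * s`! / a`!] stands for [1 / (a - s)`!], since it vanishes for
[s > a]. *)
Definition vdm_coef (a b s : nat) : rat :=
  ((2 * a)`! * (2 * b)`! * ('C(a, s) * 'C(b, s) * s`! ^ 2))%:R
    / (a`! * b`! * (a + b)`! * (2 * s)`!)%:R.

Lemma vdm_coef_small a b s : (b < s)%N -> vdm_coef a b s = 0.
Proof.
by move=> lt_bs; rewrite /vdm_coef (bin_small lt_bs) muln0 mul0n muln0 mul0r.
Qed.

Lemma vdm_coefE a b s : (s <= a)%N -> (s <= b)%N ->
  vdm_coef a b s =
  (2 * a)`!%:R * (2 * b)`!%:R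
    / ((a - s)`!%:R * (b - s)`!%:R * (a + b)`!%:R * (2 * s)`!%:R).
Proof.
move=> le_sa le_sb; rewrite /vdm_coef !natrM !natr_bin //.
by field; rewrite !natr_fact_neq0.
Qed.

Lemma vdm_coef_mul_bin a b k j : (k <= b)%N -> (k + j <= a)%N ->
  vdm_coef a b (k + j) * 'C(2 * (k + j), k + j + k)%:R =
  (2 * a)`!%:R * (2 * b)`!%:R / ((b - k)`!%:R * (a + k)`!%:R * (a + b)`!%:R)
    * ('C(b - k, j) * 'C(a + k, a - k - j))%:R.
Proof.
move=> le_kb le_a; have [lt_bj|le_jb] := ltnP (b - k) j.
  by rewrite (bin_small lt_bj) vdm_coef_small ?mul0r ?mulr0 //; lia.
rewrite natrM vdm_coefE ?natr_bin; try by lia.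
have -> : (2 * (k + j) - (k + j + k) = j)%N by lia.
have -> : (b - k - j = b - (k + j))%N by lia.
have -> : (a + k - (a - k - j) = k + j + k)%N by lia.
have -> : (a - k - j = a - (k + j))%N by lia.
by field; rewrite !natr_fact_neq0.
Qed.

Lemma bin_double_mul a b k :
  ('C(2 * a, a + k) * 'C(2 * b, b + k))%:R =
  \sum_(s < a.+1) vdm_coef a b s * 'C(2 * s, s + k)%:R.
Proof.
have [le_kab|gt_kab] := leqP k (minn a b); last first.
  rewrite big1 => [|[s /= le_sa] _].
    apply/eqP; rewrite pnatr_eq0 muln_eq0; apply/orP.
    by have [?|?] := ltnP a k; [left | right]; rewrite bin_small //; lia.
  have [lt_bs|le_sb] := ltnP b s; first by rewrite vdm_coef_small ?mul0r.
  by rewrite (@bin_small (2 * s)) ?mulr0 //; lia.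
have [le_ka le_kb] : (k <= a)%N /\ (k <= b)%N by lia.
pose F s := vdm_coef a b s * 'C(2 * s, s + k)%:R.
rewrite (big_ord_drop (m := k) (F := F)) ?subSn //; first last.
- by move=> s lt_sk; rewrite /F bin_small ?mulr0 //; lia.
- exact: leqW.
have le_kj (j : 'I_(a - k).+1) : (k + j <= a)%N by have := ltn_ord j; lia.
rewrite (eq_bigr _ (fun j _ => vdm_coef_mul_bin le_kb (le_kj j))).
rewrite -mulr_sumr -natr_sum binomial.Vandermonde natrM !natr_bin; try by lia.
have -> : (2 * a - (a + k) = a - k)%N by lia.
have -> : (2 * b - (b + k) = b - k)%N by lia.
have -> : (b - k + (a + k) = a + b)%N by lia.
have -> : (a + b - (a - k) = b + k)%N by lia.
by field; rewrite !natr_fact_neq0.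
Qed.

Definition symbin (a : nat) (k : int) : int := zbin (2 * a) (a%:Z + k).

Lemma symbinE a k : symbin a k = 'C(2 * a, a + `|k|)%:Z.
Proof.
rewrite /symbin; case: (intP k) => [|j|j]; rewrite ?addr0 ?addn0 //.
have [le_ja|lt_aj] := leqP j.+1 a.
  by rewrite subzn //= -bin_sub; [congr (Posz 'C(_, _)) |]; lia.
rewrite bin_small; last lia.
by have -> : a%:Z - j.+1%:Z = Negz (j - a) by lia.
Qed.

Lemma symbin_small a k : (a < `|k|)%N -> symbin a k = 0.
Proof. by move=> lt_ak; rewrite symbinE bin_small //; lia. Qed.

Lemma symbin_mul a b k :
  (symbin a k * symbin b k)%:~R =
  \sum_(s < a.+1) vdm_coef a b s * (symbin s k)%:~R.
Proof.
rewrite !symbinE -PoszM -pmulrn bin_double_mul; apply: eq_bigr => s _.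
by rewrite symbinE.
Qed.

Lemma sum_zrange_sym (V : nmodType) (F : int -> V) n :
  \sum_(k <- zrange (- n%:Z) n%:Z) F k = \sum_(i < (2 * n).+1) F (i%:Z - n%:Z).
Proof.
rewrite -(big_mkord xpredT (fun i : nat => F (i%:Z - n%:Z))) /index_iota subn0.
rewrite /zrange ifT ?big_map; last by lia.
have -> : `|n%:Z - - n%:Z|%N = (2 * n)%N by lia.
by apply: eq_bigr => i _; rewrite addrC.
Qed.

Definition altbinsum (K : nat) (l : seq nat) : int :=
  \sum_(k <- zrange (- K%:Z) K%:Z) (-1) ^ k * \prod_(a <- l) symbin a k.

Lemma perm_altbinsum K l1 l2 : perm_eq l1 l2 -> altbinsum K l1 = altbinsum K l2.
Proof. by move=> eq_l; apply: eq_bigr => k _; rewrite (perm_big _ eq_l). Qed.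

Lemma altbinsum_widen a K l :
  a \in l -> (a <= K)%N -> altbinsum K l = altbinsum a l.
Proof.
move=> a_l le_aK; pose near0 (k : int) := (`|k| <= a)%N.
rewrite /altbinsum -(@big_rmcond _ _ _ _ _ near0) => [|k]; last first.
  rewrite -ltnNge => lt_ak.
  by rewrite (big_rem a) //= symbin_small // mul0r mulr0.
rewrite -big_filter; apply/perm_big/uniq_perm.
- by rewrite filter_uniq ?uniq_zrange.
- exact: uniq_zrange.
- by move=> k; rewrite mem_filter !mem_zrange /near0; lia.
Qed.

Lemma altbinsum1 a K : (a <= K)%N -> altbinsum K [:: a] = (a == 0)%:Z.
Proof.
move=> le_aK; rewrite (@altbinsum_widen a) ?inE // /altbinsum.
transitivity ((-1) ^+ a * (1 - 1) ^+ (2 * a) : int); last first.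
  by rewrite subrr expr0n; case: a {le_aK} => [|a]; rewrite ?mulr0.
rewrite sum_zrange_sym exprBn mulr_sumr; apply: eq_bigr => i _.
rewrite big_seq1 /symbin subrKC /= !expr1n !mulr1 exprzDr ?unitrN1 //.
rewrite -exprnN -exprVn invrN1 -exprnP -mulr_natr natz; ring.
Qed.

Lemma altbinsum_cons2 K a b l :
  (altbinsum K [:: a, b & l])%:~R
  = \sum_(s < a.+1) vdm_coef a b s * (altbinsum K ((s : nat) :: l))%:~R.
Proof.
rewrite /altbinsum; under [RHS]eq_bigr do rewrite rmorph_sum mulr_sumr.
rewrite exchange_big rmorph_sum; apply: eq_bigr => k _ /=.
rewrite !big_cons (mulrA (symbin a k)) 2!intrM symbin_mul mulr_suml mulr_sumr.
by apply: eq_bigr => s _; rewrite big_cons !intrM; ring.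
Qed.

Lemma altbinsum2 K a b : (a <= K)%N ->
  (altbinsum K [:: a; b])%:~R
  = (2 * a)`!%:R * (2 * b)`!%:R / (a`!%:R * b`!%:R * (a + b)`!%:R) :> rat.
Proof.
move=> le_aK; rewrite altbinsum_cons2 big_ord_recl big1 => [|s _]; last first.
  by rewrite lift0 altbinsum1 ?mulr0 // (leq_trans (ltn_ord s)).
by rewrite altbinsum1 // vdm_coefE // !subn0 muln0 mulr1 addr0 mulr1.
Qed.

Definition adjsum_fact (a : nat) (l : seq nat) : nat :=
  \prod_(m <- pairmap addn a l) m`!.

Lemma adjsum_fact_cons a b l :
  adjsum_fact a (b :: l) = ((a + b)`! * adjsum_fact b l)%N.
Proof. exact: big_cons. Qed.

Lemma adjsum_fact_gt0 a l : (0 < adjsum_fact a l)%N.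
Proof. by apply: prodn_gt0 => m; apply: fact_gt0. Qed.

Lemma adjsum_fact_cat a l1 l2 :
  adjsum_fact a (l1 ++ l2) = (adjsum_fact a l1 * adjsum_fact (last a l1) l2)%N.
Proof. by rewrite /adjsum_fact pairmap_cat big_cat. Qed.

Lemma adjsum_fact_nseq a r : adjsum_fact a (nseq r a) = ((2 * a)`! ^ r)%N.
Proof.
elim: r => [|r IHr] /=; first exact: big_nil.
by rewrite adjsum_fact_cons IHr expnS mul2n addnn.
Qed.

Lemma altbinsum_vdm_sum a l K : (a <= K)%N ->
  altbinsum K (a :: l) * (a`! * (last a l)`! * adjsum_fact a l)%N%:Z =
  (vdm_sum a l * \prod_(x <- a :: l) (2 * x)`!)%N%:Z.
Proof.
move=> le_aK; apply: (@intr_inj rat); rewrite rmorphM /= -!pmulrn.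
elim: l a le_aK => [|b l IHl] a le_aK.
  rewrite altbinsum1 // /adjsum_fact big_nil big_seq1.
  by case: a {le_aK} => [|a]; rewrite ?mul0r ?mul1r.
rewrite adjsum_fact_cons !big_cons; case: l IHl => [|c l] IHl.
  rewrite altbinsum2 // /adjsum_fact !big_nil -[vdm_sum a [:: b]]/1%N /=.
  by rewrite !natrM !mulr1 mul1r; field; rewrite !natr_fact_neq0.
rewrite altbinsum_cons2 mulr_suml vdm_sum_cons2 big_distrl natr_sum.
apply: eq_bigr => -[s /= le_sa] _.
have [lt_bs|le_sb] := ltnP b s.
  rewrite vdm_coef_small // [(b + c)%N]addnC (@bin_small (c + b)) ?ltn_add2l //.
  by rewrite muln0 !mul0n !mul0r.
have adj_neq0 : (adjsum_fact c l)%:R != 0 :> rat.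
  by rewrite pnatr_eq0 -lt0n adjsum_fact_gt0.
have -> : (altbinsum K [:: s, c & l])%:~R
    = (vdm_sum s (c :: l))%:R * (\prod_(x <- [:: s, c & l]) (2 * x)`!)%:R
      / (s`!%:R * (last c l)`!%:R * (s + c)`!%:R * (adjsum_fact c l)%:R) :> rat.
  apply: (canRL (mulfK _)); first by rewrite !mulf_neq0 ?natr_fact_neq0.
  rewrite -!natrM -(IHl s (leq_trans (le_sa : s <= a)%N le_aK)).
  by rewrite adjsum_fact_cons mulnA.
rewrite vdm_coefE // !big_cons adjsum_fact_cons !natrM !natr_bin; try by lia.
have -> : (b + c - (c + s) = b - s)%N by lia.
rewrite [(s + c)%N]addnC.
by field; rewrite adj_neq0 !natr_fact_neq0.
Qed.

Lemma dvdz_altbinsum d B a l k : k \in a :: l ->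
  (B * (a`! * (last a l)`! * adjsum_fact a l)
   = \prod_(x <- a :: l) (2 * x)`!)%N ->
  (d %| vdm_sum a l)%N -> ((d * B)%N %| altbinsum k (a :: l))%Z.
Proof.
move=> k_l def_B /dvdnP[q def_sum].
rewrite -(altbinsum_widen k_l (leq_maxl k a)).
have := altbinsum_vdm_sum l (leq_maxr k a).
rewrite -def_B def_sum mulnA [RHS]PoszM => /mulIf -> //.
  by rewrite -mulnA PoszM dvdz_mull.
by rewrite eqz_nat -lt0n !muln_gt0 !fact_gt0 adjsum_fact_gt0.
Qed.

Lemma altbinsum_blocks K a r b s c t :
  altbinsum K (blocks a r b s c t) =
  \sum_(k <- zrange (- K%:Z) K%:Z)
    (-1) ^ k * symbin a k ^+ r * symbin b k ^+ s * symbin c k ^+ t.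
Proof.
apply: eq_bigr => k _.
by rewrite !big_cat !big_nseq !iter_mulr_1 /= !mulrA.
Qed.

Lemma dvdz_altbinsum_blocks d B a r b s c t k : k \in [:: a; b; c] ->
  (B * (a`! * c`! * (a + b)`! * (b + c)`!)
   = (2 * a)`! * (2 * b)`! * (2 * c)`!)%N ->
  (d %| vdm_sum a (blocks a r b s.+1 c t.+1))%N ->
  ((d * B)%N %| altbinsum k (blocks a r.+1 b s.+1 c t.+1))%Z.
Proof.
move=> k_abc def_B; apply: (@dvdz_altbinsum d B a).
  move: k_abc; rewrite !inE !mem_cat !mem_nseq /=.
  by case/or3P => ->; rewrite ?orbT.
rewrite -[blocks _ _ _ _ _ _]/(nseq r a ++ (b :: nseq s b) ++ c :: nseq t c).
do !rewrite !(last_cat, last_nseq, adjsum_fact_cat, adjsum_fact_cons) /=.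
rewrite !(big_cons, big_cat, big_nseq, iter_muln_1, adjsum_fact_nseq) /=.
transitivity ((2 * a)`! * (2 * b)`! * (2 * c)`!
  * ((2 * a)`! ^ r * (2 * b)`! ^ s * (2 * c)`! ^ t))%N; last by ring.
by rewrite -def_B; ring.
Qed.

Lemma dvdz_altbinsum_6n_n n r s t : (0 < n)%N ->
  ((2 * 'C(6 * n, n))%N
     %| altbinsum n (blocks (3 * n) r.+1 (2 * n) s.+1 n t.+1))%Z.
Proof.
move=> n_gt0; rewrite (perm_altbinsum n (perm_blocksCA _ _ _ _ _ _)).
have sum_3n_n : (3 * n + n = 4 * n)%N by rewrite addnC.
apply: dvdz_altbinsum_blocks; first by rewrite !inE eqxx !orbT.
  by rewrite sum_3n_n !mulnA -mulnDl; have <- := bin_factD n (5 * n); ring.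
by apply: prime_dvd_vdm_sum_blocks; rewrite ?sum_3n_n ?lognM ?muln_gt0.
Qed.

Lemma dvdz_altbinsum_6n_3n n r s t : (0 < n)%N ->
  ((6 * 'C(6 * n, 3 * n))%N
     %| altbinsum n (blocks (3 * n) r.+1 (2 * n) s.+1 n t.+1))%Z.
Proof.
move=> n_gt0; rewrite -[6%N]/(lcmn 2 3) muln_lcml dvdz_lcm.
have sum_n_2n : (n + 2 * n = 3 * n)%N by [].
have sum_n_3n : (n + 3 * n = 4 * n)%N by [].
have fact6n : ('C(6 * n, 3 * n) * ((3 * n)`! * (3 * n)`!) = (6 * n)`!)%N.
  by have := bin_factD (3 * n) (3 * n); rewrite -mulnDl.
apply/andP; split.
  rewrite (perm_altbinsum n (perm_blocksCA _ _ _ _ _ _)).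
  rewrite (perm_altbinsum n (perm_blocksAC _ _ _ _ _ _)).
  apply: dvdz_altbinsum_blocks; first by rewrite !inE eqxx !orbT.
    by rewrite sum_n_3n addnC sum_n_2n !mulnA -fact6n; ring.
  by apply: prime_dvd_vdm_sum_blocks; rewrite ?sum_n_3n ?lognM ?muln_gt0.
rewrite (perm_altbinsum n (perm_blocksAC _ _ _ _ _ _)).
apply: dvdz_altbinsum_blocks; first by rewrite !inE eqxx !orbT.
  by rewrite sum_n_2n [(_ + n)%N]addnC sum_n_3n !mulnA -fact6n; ring.
by apply: prime_dvd_vdm_sum_blocks; rewrite ?sum_n_2n ?lognM ?muln_gt0.
Qed.

Lemma dvdz_altbinsum_8n_3n n r s t : (0 < n)%N -> (0 < r + s + t)%N ->
  ((2 * 'C(8 * n, 3 * n))%N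
     %| altbinsum n (blocks (4 * n) r.+1 (2 * n) s.+1 n t.+1))%Z.
Proof.
move=> n_gt0 rst_gt0; have sum_n_2n : (n + 2 * n = 3 * n)%N by [].
have sum_n_4n : (n + 4 * n = 5 * n)%N by [].
have fact8n : ('C(8 * n, 3 * n) * ((3 * n)`! * (5 * n)`!) = (8 * n)`!)%N.
  by have := bin_factD (3 * n) (5 * n); rewrite -mulnDl.
have [|st_gt0] := posnP (s + t).
  case: s t rst_gt0 => [|s] [|t] //; case: r => // r _ _.
  rewrite (perm_altbinsum n (perm_blocksCA _ _ _ _ _ _)).
  rewrite (perm_altbinsum n (perm_blocksAC _ _ _ _ _ _)).
  apply: dvdz_altbinsum_blocks; first by rewrite !inE eqxx !orbT.
    by rewrite sum_n_4n addnC sum_n_2n !mulnA -fact8n; ring.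
  exact: even_vdm_sum_2n_n_4n.
rewrite (perm_altbinsum n (perm_blocksAC _ _ _ _ _ _)).
apply: dvdz_altbinsum_blocks; first by rewrite !inE eqxx !orbT.
  by rewrite sum_n_2n (addnC _ n) sum_n_4n !mulnA -fact8n; ring.
case: t st_gt0 {rst_gt0} => [|t] st_gt0; rewrite /blocks.
  case: s st_gt0 => // s _; rewrite [nseq s.+2 _]/= catA.
  by apply: even_vdm_sum_twins; rewrite ?(lognM, muln_gt0).
by apply: even_vdm_sum_twins; rewrite ?(lognM, muln_gt0).
Qed.

Theorem mainTheorem4 (r s t n : nat)
    (hr : (0 < r)%N) (hs : (0 < s)%N) (ht : (0 < t)%N) (hn : (0 < n)%N) :
  [/\ (\sum_(k <- zrange (- n%:Z) n%:Z)
          (-1) ^ k * zbin (6 * n) ((3 * n)%N%:Z + k) ^+ r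
                   * zbin (4 * n) ((2 * n)%N%:Z + k) ^+ s
                   * zbin (2 * n) (n%:Z + k) ^+ t
        = 0 %[mod (2 * 'C(6 * n, n))%N%:Z])%Z,
      (\sum_(k <- zrange (- n%:Z) n%:Z)
          (-1) ^ k * zbin (6 * n) ((3 * n)%N%:Z + k) ^+ r
                   * zbin (4 * n) ((2 * n)%N%:Z + k) ^+ s
                   * zbin (2 * n) (n%:Z + k) ^+ t
        = 0 %[mod (6 * 'C(6 * n, 3 * n))%N%:Z])%Z &
      (r, s, t) <> (1%N, 1%N, 1%N) ->
      (\sum_(k <- zrange (- n%:Z) n%:Z)
          (-1) ^ k * zbin (8 * n) ((4 * n)%N%:Z + k) ^+ r
                   * zbin (4 * n) ((2 * n)%N%:Z + k) ^+ s
                   * zbin (2 * n) (n%:Z + k) ^+ t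
        = 0 %[mod (2 * 'C(8 * n, 3 * n))%N%:Z])%Z].
Proof.
case: r hr => // r _; case: s hs => // s _; case: t ht => // t _.
have altbinsumE m a : (m = 2 * a)%N ->
    \sum_(k <- zrange (- n%:Z) n%:Z)
       (-1) ^ k * zbin m (a%:Z + k) ^+ r.+1
                * zbin (4 * n) ((2 * n)%N%:Z + k) ^+ s.+1
                * zbin (2 * n) (n%:Z + k) ^+ t.+1
      = altbinsum n (blocks a r.+1 (2 * n) s.+1 n t.+1).
  by move=> ->; rewrite altbinsum_blocks /symbin mulnA.
split=> [||rst_neq1]; rewrite altbinsumE ?mulnA // mod0z; apply/dvdz_mod0P.
- exact: dvdz_altbinsum_6n_n.
- exact: dvdz_altbinsum_6n_3n.
- apply: dvdz_altbinsum_8n_3n => //.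
  by case: r s t rst_neq1 {altbinsumE} => [|r] [|s] [|t].
Qed.
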